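(* Let $C$ be an ideal of $\mathcal{R}=\frac{GR(p^a,m)[x]}{\langle f(x)\rangle}$ with torsional degrees $T_i(C)$, $0\le i\le a-1$. Then there exist $f_0(x),f_1(x),\dots,f_{a-1}(x)\in\mathcal{R}$ such that $$C=\langle f_0(x),pf_1(x),\dots,p^{a-1}f_{a-1}(x)\rangle,$$ where $f_i(x)=0$ if $T_i(C)=t$, and otherwise $$f_i(x)=h(x)^{T_i(C)}+\sum_{j=1}^{a-1-i}p^jh(x)^{t_{i,j}}\alpha_{i,j}(x),$$ where $t_{i,j}\deg(h(x))+\deg(\alpha_{i,j}(x))<T_{i+j}(C)\deg(h(x))$ and each $\alpha_{i,j}(x)\notin\langle p,h(x)\rangle\setminus\{0\}$ (that is, each $\alpha_{i,j}(x)$ is either $0$ or not in $\langle p,h(x)\rangle$). Furthermore, the set $\{f_0(x),pf_1(x),\dots,p^{a-1}f_{a-1}(x)\}$ is the unique generating set of $C$ with these properties.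
   Context: $p$ is a prime, $a,m\ge 1$; $GR(p^a,m)$ is the Galois ring of characteristic $p^a$ with $p^{am}$ elements, a local ring with maximal ideal $\langle p\rangle$ and residue field $\mathbb{F}_{p^m}=GR(p,m)$. The map $\mu$ (also a bar) denotes reduction modulo $p$, applied coefficientwise to polynomials, and the induced map $\mathcal{R}\to\mathbb{F}_{p^m}[x]/\langle\overline{f}(x)\rangle$. $\mathcal{T}_m=\{0,1,\zeta,\dots,\zeta^{p^m-2}\}\subset GR(p^a,m)$ is the Teichmüller set ($\zeta$ of multiplicative order $p^m-1$), identified with $\mathbb{F}_{p^m}$. A polynomial in $GR(p^a,m)[x]$ is regular if it is not a zero divisor, primary if it generates a primary ideal, and basic irreducible if it is irreducible and its reduction modulo $p$ is irreducible. Standing assumption: $f(x)\in GR(p^a,m)[x]$ is a monic regular primary polynomial which is not a unit, written as $f(x)=h(x)^t+p\beta(x)$ with $t\ge 1$, $h(x)$ a monic basic irreducible polynomial with $\overline{h}(x)=h(x)$ (coefficients in $\mathcal{T}_m$), $\beta(x)\in GR(p^a,m)[x]$ and $\deg\beta(x)<t\deg h(x)$. Elements of $\mathcal{R}$ are represented by polynomials of degree less than $\deg f(x)$. For an ideal $C$ of $\mathcal{R}$ and $0\le i\le a-1$, the $i$-th torsion code is $\mathrm{Tor}_i(C)=\{\mu(v): v\in\mathcal{R},\ p^iv\in C\}$. It is an ideal of $\mathbb{F}_{p^m}[x]/\langle\overline f(x)\rangle=\mathbb{F}_{p^m}[x]/\langle\overline h(x)^t\rangle$, hence equals $\langle h(x)^{T_i}\rangle$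 for a unique $0\le T_i\le t$; $T_i(C):=T_i$ is the $i$-th torsional degree of $C$.
   Formalization: The polynomials α_{i,j}(x) are required to have coefficients in the Teichmüller set T_m; with arbitrary coefficients uniqueness fails: in Z_8[x]/<x^3>, <x^2+2, 2x, 4> = <x^2+6, 2x, 4>, and both generating sets meet all the conditions. *)

(* Defs.v *)
From HB Require Import structures.
From mathcomp Require Import all_boot all_order all_algebra.

Set Implicit Arguments.
Unset Strict Implicit.
Unset Printing Implicit Defensive.

Import GRing.Theory.
Local Open Scope ring_scope.

(* Makes {poly %/ f} a finComNzRingType when A is one. *)
HB.instance Definition _ (A : finComNzRingType) (f : {poly A}) :=
  Finite.on {poly %/ f}.

Section RingElements.
Variable A : comNzRingType.
Implicit Types x y : A.

Definition divides x y := exists z, y = z * x.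

Definition is_unit x := divides x 1.

Definition irreducible_elt x :=
  [/\ x != 0, ~ is_unit x
    & forall y z, x = y * z -> is_unit y \/ is_unit z].

Definition primary_elt x :=
  ~ is_unit x /\
  (forall y z, divides x (y * z) ->
     divides x y \/ exists n : nat, divides x (z ^+ n.+1)).

End RingElements.

Section Ideals.
Variable A : finComNzRingType.

(* The library's idealr_closed also requires 1 \notin I; here I may be A. *)
Definition is_ideal (I : {set A}) :=
  0 \in I /\ (forall a, {in I &, forall u v, a * u + v \in I}).

Definition ideal_gen (G : {set A}) : {set A} :=
  [set \sum_(g in G) c g * g | c : {ffun A -> A}].

End Ideals.

(* The third clause says that A is local with maximal ideal <p>. *)
Definition galois_ring (p a m : nat) (A : finComNzRingType) :=
  [/\ forall n : nat, (n%:R == 0 :> A) = (p ^ a %| n)%N,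
      #|A| = (p ^ (a * m))%N
    & forall x : A, is_unit x <-> ~ divides p%:R x].

Definition residue_map (p m : nat) (A : finComNzRingType) (F : finFieldType)
    (mu : {rmorphism A -> F}) :=
  [/\ #|F| = (p ^ m)%N, forall y : F, exists x : A, mu x = y
    & forall x : A, mu x = 0 <-> divides p%:R x].

(* zeta is meant to have multiplicative order p ^ m - 1. *)
Definition teichmuller (p m : nat) (A : finComNzRingType) (zeta : A) : pred A :=
  [pred z | (z == 0) || [exists k : 'I_(p ^ m).-1, z == zeta ^+ k]].

Definition basic_irreducible (A : finComNzRingType) (F : finFieldType)
    (mu : {rmorphism A -> F}) (h : {poly A}) :=
  irreducible_elt h /\ irreducible_poly (map_poly mu h).

Section Torsion.
Variables (p : nat) (A : finComNzRingType) (F : finFieldType).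
Variable mu : {rmorphism A -> F}.
Variables (f h : {poly A}) (t : nat).

Notation fbar := (map_poly mu f).

(* {poly %/ f} is the type of polynomials of degree < deg f, with the
   multiplication modulo f, provided that f is monic and deg f > 0. *)
Definition qpoly_mu (v : {poly %/ f}) : {poly %/ fbar} :=
  in_qpoly fbar (map_poly mu v).

Definition torsion_code (C : {set {poly %/ f}}) (i : nat) :
    {set {poly %/ fbar}} :=
  [set qpoly_mu v | v : {poly %/ f} & p%:R ^+ i * v \in C].

(* When h and t are as in f = h ^+ t + p * beta and C is an ideal, exactly one
   k <= t satisfies the condition, so that the default 0 is not used. *)
Definition torsional_degree (C : {set {poly %/ f}}) (i : nat) : nat :=
  if [pick k : 'I_t.+1 | torsion_code C i
        == ideal_gen [set in_qpoly fbar (map_poly mu h ^+ k)]] is Some k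
  then k else 0%N.

End Torsion.

Section StandardGenerators.
Variables (p a m : nat) (A : finComNzRingType) (zeta : A) (F : finFieldType).
Variable mu : {rmorphism A -> F}.
Variables (f h : {poly A}) (t : nat).

(* The polynomials alpha j have coefficients in the Teichmueller set, which
   stands for the residue field.  With arbitrary coefficients in A the
   uniqueness of the generators fails: for A = Z/8 and f = 'X^3, the ideal
   <'X^2 + 2, 2 * 'X, 4> is also <'X^2 + 2 * 3, 2 * 'X, 4>.
   The degree condition is empty for alpha j = 0, as deg 0 = -oo. *)
Definition standard_form (C : {set {poly %/ f}}) (i : nat) (g : {poly %/ f}) :=
  let T := torsional_degree p mu h t C in
  (T i = t -> g = 0) /\
  (T i <> t -> exists (tt : nat -> nat) (alpha : nat -> {poly A}),
     (forall j, (1 <= j < a - i)%N ->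
        [/\ alpha j \is a polyOver (teichmuller p m zeta),
            alpha j != 0 ->
              (tt j * (size h).-1 + (size (alpha j)).-1
                 < T (i + j) * (size h).-1)%N
          & in_qpoly f (alpha j)
              \notin ideal_gen [set p%:R; in_qpoly f h] :\ 0]) /\
     g = in_qpoly f
           (h ^+ T i
            + \sum_(1 <= j < a - i) p%:R ^+ j * h ^+ tt j * alpha j)).

Definition generating_set (g : 'I_a -> {poly %/ f}) : {set {poly %/ f}} :=
  [set p%:R ^+ i * g i | i : 'I_a].

Definition standard_generators (C : {set {poly %/ f}})
    (g : 'I_a -> {poly %/ f}) :=
  C = ideal_gen (generating_set g) /\
  (forall i : 'I_a, standard_form C i (g i)).

End StandardGenerators.

(* Main.v *)
Require Import Defs.
From HB Require Import structures.
From mathcomp Require Import all_boot all_order all_algebra ring.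

Set Implicit Arguments.
Unset Strict Implicit.
Unset Printing Implicit Defensive.

Import GRing.Theory.
Local Open Scope ring_scope.

(** Let [I] be the preimage of the ideal [C] in the polynomials over the Galois
    ring. For each [i], the residues of the [v] with [p ^ i * v] in [I] form an
    ideal over the residue field that contains the residue of [f], which is
    [h ^ t]; since [h] is irreducible there, the ideal is generated by
    [h ^ T i] with [T i <= t] ([torsional_degreeP]). So [I] has an element
    [p ^ i * v] with [v] congruent to [h ^ T i] modulo [p].

    A nonzero residue polynomial is [h ^ s * u] for a unique [s] and a unique
    [u] prime to [h], and [u] has a unique lift with Teichmueller coefficients.
    The products [h ^ s * alpha] thus form a set of digits for expansions in
    powers of [p] ([digit_exists], [digit_inj]): they represent every residue
    polynomial exactly once.

    Existence. Write [v] as [h ^ T i + p * w]. The expansion of [w] is computed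
    one digit at a time; at the power [p ^ (i + j)] one may first divide by an
    element of [I] with torsion [h ^ T (i + j)], so that the digit can be taken
    of degree less than that of [h ^ T (i + j)] ([reduce_tail]). This turns [v]
    into a standard form. Elements with the right torsion at every index
    generate [I], by successive elimination of the powers of [p]
    ([torsion_generators]); where [T i = t], the polynomial [f] has the right
    torsion and is 0 in the quotient.

    Uniqueness. The first digits at which two standard forms of index [i]
    differ have a difference whose residue lies in the ideal generated by
    [h ^ T (i + j)], yet has smaller degree. So these digits are congruent, hence
    equal ([reduced_tail_eq0], [standard_form_unique]). *)

(** * Ideals of a finite ring *)

Section IdealFacts.
Variable A : finComNzRingType.
Implicit Types (I G : {set A}) (g x : A).

Lemma is_idealM I a u : is_ideal I -> u \in I -> a * u \in I.
Proof. by case=> I0 IDM uI; rewrite -[a * u]addr0 IDM. Qed.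

Lemma is_ideal_sum I (J : Type) (r : seq J) (P : pred J) (E : J -> A) :
  is_ideal I -> (forall j, P j -> E j \in I) -> \sum_(j <- r | P j) E j \in I.
Proof.
move=> [I0 IDM] EI; apply: (big_ind (fun x => x \in I)) => // x y xI yI.
by rewrite -[x]mul1r IDM.
Qed.

Lemma mem_ideal_genP G x :
  reflect (exists c : A -> A, x = \sum_(g in G) c g * g) (x \in ideal_gen G).
Proof.
apply: (iffP imsetP) => [[c _ ->]|[c ->]]; first by exists c.
by exists (finfun c) => //; apply: eq_bigr => g _; rewrite ffunE.
Qed.

Lemma ideal_gen_ideal G : is_ideal (ideal_gen G).
Proof.
split=> [|a u v /mem_ideal_genP[c ->] /mem_ideal_genP[d ->]].
  by apply/mem_ideal_genP; exists (fun=> 0); rewrite big1 // => g _; rewrite mul0r.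
apply/mem_ideal_genP; exists (fun g => a * c g + d g).
rewrite mulr_sumr -big_split; apply: eq_bigr => g _.
by rewrite mulrDl mulrA.
Qed.

Lemma ideal_gen_id G g : g \in G -> g \in ideal_gen G.
Proof.
move=> gG; apply/mem_ideal_genP; exists (fun x => (x == g)%:R).
rewrite (bigD1 g) //= eqxx mul1r big1 ?addr0 // => x /andP[_ /negPf->].
by rewrite mul0r.
Qed.

Lemma ideal_gen_min G I :
  is_ideal I -> {subset G <= I} -> {subset ideal_gen G <= I}.
Proof.
move=> Iid GI x /mem_ideal_genP[c ->]; apply: is_ideal_sum => // g gG.
by apply: is_idealM => //; apply: GI.
Qed.

Lemma ideal_gen1P g x :
  reflect (exists c, x = c * g) (x \in ideal_gen [set g]).
Proof.
apply: (iffP idP) => [/mem_ideal_genP[c ->]|[c ->]].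
  by exists (c g); rewrite big_set1.
by apply: is_idealM; [apply: ideal_gen_ideal | rewrite ideal_gen_id ?set11].
Qed.

End IdealFacts.

(** * Polynomials over a field modulo powers of an irreducible one *)

Section IrreduciblePower.
Variables (F : fieldType) (h : {poly F}).
Hypothesis h_irr : irreducible_poly h.

Lemma irreducible_factor_out w :
  w != 0 -> exists s u, w = h ^+ s * u /\ ~~ (h %| u).
Proof.
have [n] := ubnP (size w); elim: n => // n IHn in w *; rewrite ltnS => wn w0.
have [/dvdpP[u wE]|hw] := boolP (h %| w); last first.
  by exists 0%N, w; rewrite expr0 mul1r.
have u0 : u != 0 by apply: contraNneq w0 => u0; rewrite wE u0 mul0r.
have [h_gt1 _] := h_irr; have h0 := irredp_neq0 h_irr.
have uw : (size u < size w)%N.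
  by rewrite wE size_mul // -subn1 ltn_subRL addnC ltn_add2l.
have [s [v [uE hv]]] := IHn u (leq_trans uw wn) u0.
by exists s.+1, v; rewrite wE uE exprSr mulrAC.
Qed.

(** As the polynomial ring is principal, such an ideal is generated by a
    divisor of the power of [h]; Bezout applied to the part of [w] prime to
    [h] makes this explicit. *)
Lemma ideal_containing_irreducible_power (P : pred {poly F}) t :
    (forall a u v, P u -> P v -> P (a * u + v)) -> P (h ^+ t) ->
  exists2 k, (k <= t)%N & forall w, P w = (h ^+ k %| w).
Proof.
move=> PDM Pt; have exP : exists k, P (h ^+ k) by exists t.
have [k Pk kmin] := ex_minnP exP; exists k; first exact: kmin.
have P0 : P 0 by rewrite -[0](addNr (h ^+ t)) -mulN1r PDM.
move=> w; apply/idP/idP => [Pw|/dvdpP[q ->]]; last first.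
  by rewrite -[q * _]addr0 PDM.
have [->|w0] := eqVneq w 0; first exact: dvdp0.
have [s [u [wE hu]]] := irreducible_factor_out w0.
rewrite wE; apply: dvdp_mulr; apply: dvdp_exp2l; apply: kmin.
have /Bezout_eq1_coprimepP[[a b] /= ab1] : coprimep u (h ^+ t).
  by rewrite coprimep_sym coprimep_expl // irreducible_poly_coprime.
rewrite -[h ^+ s]mul1r -ab1 mulrDl -!mulrA (mulrC u) -wE PDM //.
by rewrite -[_ * _]addr0 (mulrC (h ^+ t)) mulrA PDM.
Qed.

End IrreduciblePower.

(** * Reduction modulo p and the Teichmueller set *)

Section Residue.
Variables (p m : nat) (A : finComNzRingType) (F : finFieldType).
Variable mu : {rmorphism A -> F}.
Hypothesis mu_res : residue_map p m mu.

Lemma mu_char : p%:R = 0 :> F.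
Proof.
have [_ _ muK] := mu_res; rewrite -(rmorph_nat mu); apply/muK.
by exists 1; rewrite mul1r.
Qed.

(** If [x - y] is divisible by [p ^ i] with [i > 0], then so is
    [(x ^+ p - y ^+ p) / (x - y)] by [p], being congruent to [p * y ^+ p.-1];
    each p-th power thus gains one factor [p]. *)
Lemma expn_congr (x y : A) k : mu x = mu y ->
  divides (p%:R ^+ k.+1) (x ^+ (p ^ k) - y ^+ (p ^ k)).
Proof.
have [_ _ muK] := mu_res; move=> muxy.
elim: k => [|k [z zE]].
  by rewrite !expr1; apply/muK; rewrite rmorphB /= muxy subrr.
rewrite expnSr !exprM subrXX zE.
set S := \sum_(_ < _) _; suff /muK[s ->] : mu S = 0.
  by exists (z * s); rewrite mulrACA -exprSr.
rewrite rmorph_sum (eq_bigr (fun=> mu (x ^+ (p ^ k)) ^+ p.-1)) => [|i _].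
  by rewrite sumr_const card_ord -[LHS]mulr_natr mu_char mulr0.
rewrite rmorphM !rmorphXn /= -muxy -exprD subnK //.
by rewrite -ltnS (ltn_predK (ltn_ord i)).
Qed.

Section Teichmuller.
Variables (a : nat) (zeta : A).
Hypotheses (p_prime : prime p) (m_gt0 : (0 < m)%N).
Hypothesis p_nilp : p%:R ^+ a = 0 :> A.
Hypothesis zeta_order : ((p ^ m).-1).-primitive_root zeta.

Notation T := (teichmuller p m zeta).

Lemma teichmuller0 : 0 \in T. Proof. by rewrite inE eqxx. Qed.

Lemma teichmuller_frobenius z : z \in T -> z ^+ (p ^ m) = z.
Proof.
have pm_gt0 : (0 < p ^ m)%N by rewrite expn_gt0 prime_gt0.
rewrite inE => /orP[/eqP->|/existsP[k /eqP->]]; first by rewrite expr0n gtn_eqF.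
rewrite -exprM mulnC exprM -{1}(prednK pm_gt0) exprS.
by rewrite (prim_expr_order zeta_order) mulr1.
Qed.

(** Elements of the Teichmueller set are p^m-th powers of themselves, so that
    taking iterated p-th powers does not change them, while it makes congruent
    elements equal because [p] is nilpotent. *)
Lemma teichmuller_inj : {in T &, injective mu}.
Proof.
move=> x y xT yT muxy.
have powT z : z \in T -> z ^+ (p ^ (m * a)) = z.
  move=> zT; elim: (a) => [|n IHn]; first by rewrite muln0 expn0.
  by rewrite mulnS expnD exprM teichmuller_frobenius.
have [z] := expn_congr (m * a) muxy; rewrite !powT //.
have a_le : (a <= (m * a).+1)%N by rewrite leqW // leq_pmull.
by rewrite -(subnK a_le) exprD p_nilp !mulr0 => /subr0_eq.
Qed.

(** By counting: [mu] is injective on the Teichmueller set, whose [p ^ m]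
    elements are as many as those of [F]. *)
Lemma teichmuller_surj c : exists2 z, z \in T & mu z = c.
Proof.
have [cardF _ _] := mu_res.
have n_gt0 := prim_order_gt0 zeta_order.
pose Tset : {set A} := 0 |: [set zeta ^+ (k : 'I_(p ^ m).-1) | k : 'I_(p ^ m).-1].
have TsetP z : z \in Tset -> z \in T.
  rewrite !inE => /orP[->//|/imsetP[k _ ->]].
  by apply/orP; right; apply/existsP; exists k.
have cardT : #|Tset| = #|F|.
  have zeta_neq0 k : zeta ^+ k != 0.
    apply: contraTneq isT => zk0; have := prim_expr_order zeta_order.
    move/(congr1 (fun x => x ^+ k)); rewrite -exprM mulnC exprM zk0 expr1n.
    by rewrite expr0n gtn_eqF // => /eqP; rewrite eq_sym oner_eq0.
  rewrite cardsU1 card_imset => [|i j /eqP].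
    rewrite card_ord cardF (_ : 0 \notin _) ?add1n ?prednK ?expn_gt0 ?prime_gt0 //.
    by apply/imsetP => -[k _] /eqP; rewrite eq_sym (negPf (zeta_neq0 _)).
  rewrite (eq_prim_root_expr zeta_order) !modn_small // => /eqP; exact: val_inj.
suff : c \in mu @: Tset by case/imsetP => z /TsetP zT ->; exists z.
suff -> : mu @: Tset = setT by rewrite inE.
apply/eqP; rewrite eqEcard subsetT cardsT -cardT card_in_imset ?leqnn //.
by move=> x y /TsetP xT /TsetP yT; apply: teichmuller_inj.
Qed.

End Teichmuller.

Notation "v ^mu" := (map_poly mu v) (at level 2, format "v ^mu").

Lemma mu_poly_natr n : (n%:R : {poly A})^mu = n%:R.
Proof. exact: rmorph_nat. Qed.

Lemma mu_poly_eq0 (v : {poly A}) : v^mu = 0 -> exists w, v = p%:R * w.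
Proof.
have [_ _ muK] := mu_res.
elim/poly_ind: v => [|v c IHv] v0; first by exists 0; rewrite mulr0.
have c0 : mu c = 0.
  by have := congr1 (coefp 0) v0; rewrite /= coef_map coef0 coefD coefMX coefC add0r.
move: v0; rewrite rmorphD rmorphM /= map_polyX map_polyC /= c0 polyC0 addr0.
move/eqP; rewrite mulf_eq0 polyX_eq0 orbF => /eqP/IHv[w ->].
have /muK[d ->] := c0; exists (w * 'X + d%:P).
by rewrite mulrDr mulrA polyCM polyC_natr [d%:P * _]mulrC.
Qed.

(** Zero coefficients lift to 0, which is what keeps the degree from growing. *)
Lemma poly_lift (S : pred A) (q : {poly F}) :
    0 \in S -> (forall c, exists2 z, z \in S & mu z = c) ->
  exists v : {poly A}, [/\ v \is a polyOver S, v^mu = q & (size v <= size q)%N].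
Proof.
move=> S0 S_surj.
have liftP c : exists z, (z \in S) && (mu z == c).
  by have [z zS <-] := S_surj c; exists z; rewrite zS eqxx.
pose lift c := xchoose (liftP c).
have liftS c : lift c \in S by have /andP[] := xchooseP (liftP c).
have liftK c : mu (lift c) = c by have /andP[_ /eqP] := xchooseP (liftP c).
exists (\poly_(i < size q) lift q`_i); split; last exact: size_poly.
  apply/(all_nthP 0) => i _; rewrite coef_poly.
  by case: ifP => _; [apply: liftS | apply: S0].
apply/polyP => i; rewrite coef_map coef_poly; case: ltnP => [_|?] //=.
by rewrite rmorph0 nth_default.
Qed.

Lemma mu_poly_surj (q : {poly F}) : exists v : {poly A}, v^mu = q.
Proof.
have [_ mu_surj _] := mu_res.
have [|c|v [_ vE _]] := @poly_lift predT q; rewrite ?inE //; last by exists v.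
by have [z zE] := mu_surj c; exists z.
Qed.

Lemma polyOver_mu_inj (S : pred A) (v w : {poly A}) :
    0 \in S -> {in S &, injective mu} ->
  v \is a polyOver S -> w \is a polyOver S -> v^mu = w^mu -> v = w.
Proof.
move=> S0 S_inj; have coefS (u : {poly A}) i : u \is a polyOver S -> u`_i \in S.
  move=> /(all_nthP 0) uS; have [/uS//|?] := ltnP i (size u).
  by rewrite nth_default.
move=> vS wS vw; apply/polyP => i; apply: S_inj; rewrite ?coefS //.
by rewrite -!coef_map vw.
Qed.

End Residue.

(** * Digit expansions relative to a monic polynomial *)

Section Digits.
Variables (p m : nat) (A : finComNzRingType) (F : finFieldType).
Variable mu : {rmorphism A -> F}.
Hypothesis mu_res : residue_map p m mu.
Variable S : pred A.
Hypotheses (S0 : 0 \in S) (S_inj : {in S &, injective mu}).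
Hypothesis S_surj : forall c, exists2 z, z \in S & mu z = c.
Variable h : {poly A}.

Notation "v ^mu" := (map_poly mu v) (at level 2, format "v ^mu").

Hypotheses (h_monic : h \is monic) (h_irr : irreducible_poly h^mu).

Lemma size_mu_monic (v : {poly A}) : v \is monic -> size v^mu = size v.
Proof. by move=> v1; rewrite size_map_poly_id0 // (monicP v1) rmorph1 oner_eq0. Qed.

Lemma size_mu_expn k : size (h^mu ^+ k) = (k * (size h).-1).+1.
Proof.
by rewrite (polySpred (monic_neq0 (monic_exp k (monic_map mu h_monic))))
  size_exp size_mu_monic // mulnC.
Qed.

(** [h ^+ s * alpha] is the form of the coefficient of a power of [p] in a
    standard generator, [N] being the torsional degree that bounds it. *)
Definition digit (N s : nat) (alpha : {poly A}) :=
  [/\ alpha \is a polyOver S,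
      alpha != 0 ->
        (s * (size h).-1 + (size alpha).-1 < N * (size h).-1)%N
    & alpha = 0 \/ ~~ (h^mu %| alpha^mu)].

(** Over the residue field, [s] is the multiplicity of [h] in the polynomial
    and [alpha] lifts the cofactor. *)
Lemma digit_exists N (r : {poly F}) : (size r <= N * (size h).-1)%N ->
  exists s alpha, digit N s alpha /\ (h ^+ s * alpha)^mu = r.
Proof.
move=> rN; have [->|r0] := eqVneq r 0.
  exists 0%N, 0; rewrite mulr0 rmorph0; split=> //.
  split; [by apply/allP => x; rewrite polyseq0 | by rewrite eqxx | by left].
have [s [u [rE hu]]] := irreducible_factor_out h_irr r0.
have u0 : u != 0 by apply: contraNneq r0 => u0; rewrite rE u0 mulr0.
have [alpha [alphaS alphaE szalpha]] := poly_lift u S0 S_surj.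
exists s, alpha; rewrite rmorphM rmorphXn /= alphaE -rE; split=> //.
split=> // [alpha0|]; last by right; rewrite alphaE.
apply: leq_trans rN; rewrite rE size_mul ?expf_neq0 ?(irredp_neq0 h_irr) //.
rewrite size_mu_expn addSn /= -addnS leq_add2l prednK //.
by rewrite size_poly_gt0.
Qed.

Lemma digit_size N s alpha : digit N s alpha ->
  (size (h ^+ s * alpha)^mu <= N * (size h).-1)%N.
Proof.
case=> _ szalpha _; have [->|alpha0] := eqVneq alpha 0.
  by rewrite mulr0 rmorph0 size_poly0.
rewrite rmorphM rmorphXn /=; apply: leq_trans (szalpha alpha0).
rewrite (leq_trans (size_polyMleq _ _)) // size_mu_expn addSn /= -addnS leq_add2l.
by rewrite prednK ?size_poly_gt0 // size_poly.
Qed.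

(** The residue determines [s], as the multiplicity of [h] in it, and then
    the residue of [alpha], which determines [alpha] because [S] is a
    transversal; the value 0 has to be treated apart, [s] being free in it. *)
Lemma digit_inj N N' s s' alpha alpha' :
    digit N s alpha -> digit N' s' alpha' ->
    (h ^+ s * alpha)^mu = (h ^+ s' * alpha')^mu ->
  h ^+ s * alpha = h ^+ s' * alpha'.
Proof.
have h0 := irredp_neq0 h_irr.
wlog le_ss' : N N' s s' alpha alpha' / (s <= s')%N => [IH d d' /esym dd'|].
  have /orP[?|?] := leq_total s s'; first exact: (IH N N').
  by apply/esym; apply: (IH N' N).
move=> [alphaS _ alphaP] [alphaS' _ alphaP'].
rewrite -(subnKC le_ss') exprD -mulrA !rmorphM !rmorphXn /=.
move/(mulfI (expf_neq0 s h0)).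
case: (posnP (s' - s)) => [->|ss'_gt0].
  by rewrite expr0 !mul1r => /(polyOver_mu_inj S0 S_inj alphaS alphaS')->.
move=> alphaE; have halpha : h^mu %| alpha^mu.
  by rewrite alphaE -(prednK ss'_gt0) exprS -mulrA dvdp_mulIl.
case: alphaP => [alpha0|/negP//]; move/esym: alphaE; rewrite alpha0 rmorph0.
move/eqP; rewrite mulf_eq0 expf_eq0 (negPf h0) andbF /= => /eqP alpha0'.
suff -> : alpha' = 0 by rewrite !mulr0.
case: alphaP' => [//|]; by rewrite alpha0' dvdp0.
Qed.

(** * Ideals of polynomials and their torsion *)

Section TorsionIdeal.
Variables (a t : nat) (I : pred {poly A}) (T : nat -> nat).
Hypothesis p_nilp : p%:R ^+ a = 0 :> A.
Hypotheses (I0 : 0 \in I)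
  (IDM : forall c u v, u \in I -> v \in I -> c * u + v \in I).
(** Together, these say that the T i-th power of [h] generates the i-th torsion
    ideal of [I], the set of residues of the [v] with [p ^ i * v] in [I]. *)
Hypothesis torsion_dvd : forall i v, (i < a)%N ->
  p%:R ^+ i * v \in I -> h^mu ^+ T i %| v^mu.
Hypothesis torsion_gen : forall i, (i < a)%N ->
  exists2 v, p%:R ^+ i * v \in I & v^mu = h^mu ^+ T i.

Lemma p_nilp_poly : p%:R ^+ a = 0 :> {poly A}.
Proof. by rewrite -polyC_natr -polyC_exp p_nilp. Qed.

(** The part of a standard generator of index [i] from [p ^ k] on. *)
Definition tail i k (s : nat -> nat) (alpha : nat -> {poly A}) :=
  \sum_(k <= j < a - i) p%:R ^+ j * h ^+ s j * alpha j.

(** Divide the residue of [r] by [h ^+ T (i + k)]: the quotient is absorbed by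
    a multiple of the element of [I] whose (i + k)-th torsion is
    [h ^+ T (i + k)], the remainder is a digit, and the difference is a
    multiple of [p], to be treated at the next power of [p]. *)
Lemma reduce_tail i k r : (i + k <= a)%N ->
  exists s alpha,
    (forall j, (k <= j < a - i)%N -> digit (T (i + j)) (s j) (alpha j)) /\
    p%:R ^+ i * (p%:R ^+ k * r - tail i k s alpha) \in I.
Proof.
move=> ik_le; have [n nE] : exists n, (a - i)%N = (n + k)%N.
  by exists (a - i - k)%N; rewrite subnK // leq_subRL ?(leq_trans _ ik_le) ?leq_addr.
elim: n => [|n IHn] in k r ik_le nE *.
  exists (fun=> 0%N), (fun=> 0); split=> [j|].
    by rewrite nE add0n; case: ltngtP.
  rewrite /tail nE big_geq // subr0 mulrA -exprD.
  rewrite -[k]add0n -nE subnKC ?p_nilp_poly ?mul0r //.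
  by rewrite (leq_trans _ ik_le) ?leq_addr.
have k_lt : (k < a - i)%N by rewrite nE ltnS leq_addl.
have ik_lt : (i + k < a)%N by rewrite -ltn_subRL.
have [v vI vE] := torsion_gen ik_lt.
pose d := h^mu ^+ T (i + k).
have d0 : d != 0 by rewrite expf_neq0 ?(irredp_neq0 h_irr).
have [|s0 [alpha0 [digit0 digit0E]]] := @digit_exists (T (i + k)) (r^mu %% d).
  by rewrite -ltnS -size_mu_expn ltn_modp.
have [q qE] := mu_poly_surj mu_res (r^mu %/ d).
have [r' r'E] : exists r', r - q * v - h ^+ s0 * alpha0 = p%:R * r'.
  apply: (mu_poly_eq0 mu_res).
  rewrite !rmorphB /= digit0E (rmorphM _ q) /= qE vE [X in X - _ - _](divp_eq _ d).
  by rewrite -/d -addrA -opprD subrr.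
have [||s [alpha [sP restI]]] := IHn k.+1 r'; rewrite ?addnS //.
exists (fun j => if j == k then s0 else s j).
exists (fun j => if j == k then alpha0 else alpha j); split=> [j|].
  case: eqVneq => [-> //|jk] /andP[kj ja]; apply: sP.
  by rewrite ja ltn_neqAle eq_sym jk kj.
rewrite /tail big_ltn // eqxx (eq_big_nat _ _ (F2 := fun j =>
  p%:R ^+ j * h ^+ s j * alpha j)) => [|j /andP[kj _]]; last first.
  by rewrite gtn_eqF.
rewrite -/(tail i k.+1 s alpha).
set X := tail _ _ _ _ in restI *.
have rE : r = q * v + h ^+ s0 * alpha0 + p%:R * r'.
  by rewrite -r'E; ring.
have -> : p%:R ^+ i * (p%:R ^+ k * r - (p%:R ^+ k * h ^+ s0 * alpha0 + X)) =
   q * (p%:R ^+ (i + k) * v) + p%:R ^+ i * (p%:R ^+ k.+1 * r' - X).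
  by rewrite rE exprD exprSr; ring.
exact: IDM.
Qed.

(** An element of [I] that is a multiple of [p ^ k] is, up to a multiple of
    [p ^ k.+1], a multiple of any element of [I] with the same k-th torsion as
    [I]. *)
Lemma torsion_generators (G : nat -> {poly A}) v :
    (forall i, (i < a)%N ->
       p%:R ^+ i * G i \in I /\ (G i)^mu = h^mu ^+ T i) ->
    v \in I ->
  exists c : nat -> {poly A}, v = \sum_(0 <= i < a) c i * (p%:R ^+ i * G i).
Proof.
move=> GP vI.
suff H n k w : a = (n + k)%N -> p%:R ^+ k * w \in I ->
    exists c : nat -> {poly A},
      p%:R ^+ k * w = \sum_(k <= i < a) c i * (p%:R ^+ i * G i).
  have [||c cE] := H a 0%N v; rewrite ?addn0 ?expr0 ?mul1r //.
  by exists c; rewrite -cE expr0 mul1r.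
elim: n => [|n IHn] in k w *.
  rewrite add0n => <- _; exists (fun=> 0).
  by rewrite big_geq // p_nilp_poly mul0r.
move=> aE wI; have k_lt : (k < a)%N by rewrite aE ltnS leq_addl.
have [GI GE] := GP k k_lt.
have /dvdpP[q0 q0E] := torsion_dvd k_lt wI.
have [q qE] := mu_poly_surj mu_res q0.
have [w' w'E] : exists w', w - q * G k = p%:R * w'.
  by apply: (mu_poly_eq0 mu_res); rewrite rmorphB rmorphM /= qE GE q0E subrr.
have wE : p%:R ^+ k * w = q * (p%:R ^+ k * G k) + p%:R ^+ k.+1 * w'.
  by rewrite exprSr -mulrA -w'E mulrBr mulrCA addrC subrK.
have [||c cE] := IHn k.+1 w'; first by rewrite aE addnS.
  by rewrite -[X in X \in I](addrK (q * (p%:R ^+ k * G k))) addrC -mulNr IDM // addrC -wE.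
exists (fun i => if i == k then q else c i).
rewrite wE cE [RHS]big_ltn //= eqxx; congr (_ + _).
by apply: eq_big_nat => i /andP[ki _]; rewrite gtn_eqF.
Qed.

(** The residue of the first nonzero [e k] lies in the (i + k)-th torsion ideal
    and has degree below that of its generator. Applied to differences of
    digits, this is the uniqueness of reduced expansions. *)
Lemma reduced_tail_eq0 i (e : nat -> {poly A}) :
    (forall j, (1 <= j < a - i)%N ->
       (size (e j)^mu <= T (i + j) * (size h).-1)%N) ->
    (forall j, (1 <= j < a - i)%N -> (e j)^mu = 0 -> e j = 0) ->
    p%:R ^+ i * (\sum_(1 <= j < a - i) p%:R ^+ j * e j) \in I ->
  forall j, (1 <= j < a - i)%N -> e j = 0.
Proof.
move=> e_size e_mu sumI j; have [n] := ubnP j.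
elim: n => // n IHn in j *; rewrite ltnS => jn /andP[j_gt0 j_lt].
have {}IHn k : (1 <= k < j)%N -> e k = 0.
  move=> /andP[k_gt0 kj]; apply: IHn; first exact: leq_trans kj jn.
  by rewrite k_gt0 (ltn_trans kj).
apply: e_mu; rewrite ?j_gt0 //.
have ij_lt : (i + j < a)%N by rewrite -ltn_subRL.
pose w := \sum_(j.+1 <= k < a - i) p%:R ^+ (k - j.+1) * e k.
have sumE : \sum_(1 <= k < a - i) p%:R ^+ k * e k = p%:R ^+ j * (e j + p%:R * w).
  rewrite (big_cat_nat (n := j)) //= ?(ltnW j_lt) // big_nat big1 ?add0r => [|k kP].
    rewrite big_ltn // mulrDr mulrA -exprSr mulr_sumr; congr (_ + _).
    by apply: eq_big_nat => k /andP[jk _]; rewrite mulrA -exprD subnKC.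
  by rewrite IHn ?mulr0.
move: sumI; rewrite sumE mulrA -exprD => /(torsion_dvd ij_lt).
rewrite rmorphD rmorphM /= rmorph_nat -polyC_natr (mu_char mu_res) polyC0 mul0r addr0.
move=> dvd_e; apply/eqP; apply: contraTT isT => e0.
have := dvdp_leq e0 dvd_e; rewrite size_mu_expn ltnNge e_size //.
by rewrite j_gt0.
Qed.

End TorsionIdeal.
End Digits.

(** * Quotients by monic polynomials *)

Section MonicQuotient.
Variables (R : finComNzRingType) (g : {poly R}).

Lemma in_qpoly_val (x : {poly %/ g}) : in_qpoly g (x : {poly R}) = x.
Proof. by apply: val_inj; exact: in_qpoly_small (size_mk_monic x). Qed.

Hypotheses (g_monic : g \is monic) (g_size : (1 < size g)%N).

Lemma mk_monic_id : mk_monic g = g.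
Proof. by rewrite /mk_monic g_size g_monic. Qed.

Lemma in_qpoly_eq0P v : reflect (exists q, v = q * g) (in_qpoly g v == 0).
Proof.
apply: (iffP eqP) => [v0|[q ->]].
  exists (Pdiv.Ring.rdivp v g).
  rewrite {1}(Pdiv.RingMonic.rdivp_eq g_monic v).
  by move/(congr1 val): v0; rewrite /= mk_monic_id => ->; rewrite addr0.
by apply: val_inj; rewrite /= mk_monic_id Pdiv.RingMonic.rmodp_mull.
Qed.

Lemma in_qpoly_mull q : in_qpoly g (q * g) = 0.
Proof. by apply/eqP/in_qpoly_eq0P; exists q. Qed.

Lemma in_qpoly_eqP v w :
  reflect (exists q, v = w + q * g) (in_qpoly g v == in_qpoly g w).
Proof.
rewrite -subr_eq0 -rmorphB; apply: (iffP (in_qpoly_eq0P _)) => -[q E]; exists q.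
  by rewrite -E addrC subrK.
by rewrite E addrC addKr.
Qed.

Lemma in_qpoly_decomp v : exists q, v = (in_qpoly g v : {poly R}) + q * g.
Proof. by apply/in_qpoly_eqP; rewrite in_qpoly_val. Qed.

End MonicQuotient.

Section TorsionalDegree.
Variables (p m : nat) (A : finComNzRingType) (F : finFieldType).
Variable mu : {rmorphism A -> F}.
Hypothesis mu_res : residue_map p m mu.
Variables (f h : {poly A}) (t : nat).

Notation "v ^mu" := (map_poly mu v) (at level 2, format "v ^mu").

Hypotheses (f_monic : f \is monic) (f_size : (1 < size f)%N).
Hypotheses (h_irr : irreducible_poly h^mu) (f_mu : f^mu = h^mu ^+ t).

Lemma fbar_monic : f^mu \is monic. Proof. exact: monic_map. Qed.

Lemma fbar_size : (1 < size f^mu)%N. Proof. by rewrite size_mu_monic. Qed.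

Lemma qpoly_mu_in (v : {poly A}) :
  qpoly_mu mu (in_qpoly f v) = in_qpoly f^mu v^mu.
Proof.
have [q vE] := in_qpoly_decomp f_monic f_size v.
apply/esym/eqP/(in_qpoly_eqP fbar_monic fbar_size); exists q^mu.
by rewrite {1}vE rmorphD rmorphM.
Qed.

Lemma dvdp_mu_in_qpoly (d : {poly F}) (v : {poly A}) : d %| f^mu ->
  (d %| (in_qpoly f v : {poly A})^mu) = (d %| v^mu).
Proof.
move=> df; have [q vE] := in_qpoly_decomp f_monic f_size v.
by rewrite [in RHS]vE rmorphD rmorphM /= dvdp_addl // dvdp_mull.
Qed.

Lemma in_qpoly_natrM i (v : {poly A}) :
  in_qpoly f (p%:R ^+ i * v) = p%:R ^+ i * in_qpoly f v.
Proof. by rewrite rmorphM rmorphXn rmorph_nat. Qed.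

(** The standard clause on [alpha], read off from its residue: [f] lies in the
    ideal generated by [p] and [h], so this ideal of the quotient is the
    preimage of the one generated by the residue of [h]. *)
Lemma mem_ideal_p_h (v : {poly A}) : (0 < t)%N ->
  (in_qpoly f v \in ideal_gen [set p%:R; in_qpoly f h]) = (h^mu %| v^mu).
Proof.
move=> t_gt0; have hf : h^mu %| f^mu by rewrite f_mu dvdp_exp.
pose J := [set x : {poly %/ f} | h^mu %| (x : {poly A})^mu].
have inJ w : (in_qpoly f w \in J) = (h^mu %| w^mu) by rewrite inE dvdp_mu_in_qpoly.
have J_ideal : is_ideal J.
  split=> [|b x y]; first by rewrite -(rmorph0 (in_qpoly f)) inJ rmorph0 dvdp0.
  rewrite -[b]in_qpoly_val -[x]in_qpoly_val -[y]in_qpoly_val -rmorphM -rmorphD.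
  by rewrite !inJ rmorphD rmorphM /= => hx hy; rewrite dvdp_add // dvdp_mull.
apply/idP/idP => [|/dvdpP[q vE]].
  rewrite -inJ; apply: ideal_gen_min J_ideal _ _ => x /set2P[]->; last by rewrite inJ.
  by rewrite -(rmorph_nat (in_qpoly f)) inJ mu_poly_natr -polyC_natr
    (mu_char mu_res) dvdp0.
have [w wE] := mu_poly_surj mu_res q.
have [w' w'E] : exists w', v - w * h = p%:R * w'.
  by apply: (mu_poly_eq0 mu_res); rewrite rmorphB rmorphM /= wE vE subrr.
have -> : v = w * h + w' * p%:R by rewrite [w' * _]mulrC -w'E addrC subrK.
rewrite rmorphD !rmorphM /= rmorph_nat.
have [_ IDM] := ideal_gen_ideal [set p%:R; in_qpoly f h].
apply: (IDM); first by rewrite ideal_gen_id ?set22.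
by apply: is_idealM (ideal_gen_ideal _) _; rewrite ideal_gen_id ?set21.
Qed.

Lemma mem_ideal_h_expn k (w : {poly F}) : (k <= t)%N ->
  (in_qpoly f^mu w \in ideal_gen [set in_qpoly f^mu (h^mu ^+ k)])
    = (h^mu ^+ k %| w).
Proof.
move=> kt; apply/ideal_gen1P/dvdpP => [[c]|[q ->]]; last first.
  by exists (in_qpoly f^mu q); rewrite rmorphM.
rewrite -[c]in_qpoly_val -rmorphM => /eqP/(in_qpoly_eqP fbar_monic fbar_size)[q ->].
exists ((c : {poly F}) + q * h^mu ^+ (t - k)).
by rewrite mulrDl -mulrA -exprD subnK // -f_mu.
Qed.

Variable C : {set {poly %/ f}}.
Hypothesis C_ideal : is_ideal C.

Lemma mem_torsion_codeP i (w : {poly F}) :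
  reflect (exists2 v, in_qpoly f (p%:R ^+ i * v) \in C & v^mu = w)
          (in_qpoly f^mu w \in torsion_code p mu C i).
Proof.
apply: (iffP imsetP) => [[x]|[v vC <-]]; last first.
  by exists (in_qpoly f v); rewrite ?qpoly_mu_in // inE -in_qpoly_natrM.
rewrite inE -[x]in_qpoly_val qpoly_mu_in => xC.
move/eqP/(in_qpoly_eqP fbar_monic fbar_size) => [q ->].
have [w' <-] := mu_poly_surj mu_res q.
exists ((x : {poly A}) + w' * f); last by rewrite rmorphD rmorphM.
by rewrite in_qpoly_natrM rmorphD /= (in_qpoly_mull f_monic f_size) addr0.
Qed.

(** Preimages of torsion codes in the polynomials over the residue field are
    ideals that contain the residue of [f], a power of that of [h]. *)
Lemma torsional_degreeP i (T := torsional_degree p mu h t C i) :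
  (T <= t)%N /\
  forall w, (in_qpoly f^mu w \in torsion_code p mu C i) = (h^mu ^+ T %| w).
Proof.
have [C0 CDM] := C_ideal.
have [||k kt kP] := @ideal_containing_irreducible_power F h^mu h_irr
    [pred w | in_qpoly f^mu w \in torsion_code p mu C i] t.
- move=> b u v /= /mem_torsion_codeP[u' u'C <-] /mem_torsion_codeP[v' v'C <-].
  have [b' <-] := mu_poly_surj mu_res b.
  apply/mem_torsion_codeP; exists (b' * u' + v'); last by rewrite rmorphD rmorphM.
  by rewrite mulrDr mulrCA rmorphD rmorphM CDM.
- rewrite /= -f_mu; apply/mem_torsion_codeP; exists f => //.
  by rewrite in_qpoly_mull.
have genP : torsion_code p mu C i == ideal_gen [set in_qpoly f^mu (h^mu ^+ k)].
  by apply/eqP/setP => x; rewrite -[x]in_qpoly_val mem_ideal_h_expn // -kP.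
rewrite {}/T /torsional_degree; case: pickP => [k' /eqP k'P|/(_ (inord k))].
  rewrite -ltnS ltn_ord; split=> // w.
  by rewrite k'P mem_ideal_h_expn // -ltnS.
by rewrite inordK ?ltnS // genP.
Qed.

End TorsionalDegree.

(** * Existence and uniqueness of the standard generators *)

Section StandardForm.
Variables (p a m : nat) (A : finComNzRingType) (F : finFieldType).
Variable mu : {rmorphism A -> F}.
Hypothesis mu_res : residue_map p m mu.
Variable zeta : A.

Notation "v ^mu" := (map_poly mu v) (at level 2, format "v ^mu").
Notation S := (teichmuller p m zeta).

Hypotheses (S_inj : {in S &, injective mu})
  (S_surj : forall c, exists2 z, z \in S & mu z = c).
Hypothesis p_nilp : p%:R ^+ a = 0 :> A.
Variables (f h : {poly A}) (t : nat).
Hypotheses (f_monic : f \is monic) (h_monic : h \is monic) (t_gt0 : (0 < t)%N).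
Hypotheses (h_irr : irreducible_poly h^mu) (f_mu : f^mu = h^mu ^+ t).
Variable C : {set {poly %/ f}}.
Hypothesis C_ideal : is_ideal C.

Notation T := (torsional_degree p mu h t C).
Notation I := [pred v | in_qpoly f v \in C].
Notation standard := (standard_form p a m zeta mu h t C).

Lemma size_power_lift : size f = (t * (size h).-1).+1.
Proof. by rewrite -(size_mu_monic mu f_monic) f_mu size_mu_expn. Qed.

Lemma power_lift_size_gt1 : (1 < size f)%N.
Proof.
rewrite size_power_lift ltnS muln_gt0 t_gt0 -(size_mu_monic mu h_monic).
by have [h_gt1 _] := h_irr; rewrite -ltnS prednK // ltnW.
Qed.

Let f_size := power_lift_size_gt1.

Lemma torsional_degree_le i : (T i <= t)%N.
Proof. by have [] := torsional_degreeP mu_res f_monic f_size h_irr f_mu C_ideal i. Qed.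

Lemma torsional_degree_mem i w :
  (in_qpoly f^mu w \in torsion_code p mu C i) = (h^mu ^+ T i %| w).
Proof. by have [] := torsional_degreeP mu_res f_monic f_size h_irr f_mu C_ideal i. Qed.

Lemma preimage_ideal : 0 \in I /\
  forall c u v, u \in I -> v \in I -> c * u + v \in I.
Proof.
have [C0 CDM] := C_ideal; split=> [|c u v]; rewrite !inE ?rmorph0 //.
by move=> uC vC; rewrite rmorphD rmorphM CDM.
Qed.

Lemma preimage_torsion_dvd i v : (i < a)%N ->
  p%:R ^+ i * v \in I -> h^mu ^+ T i %| v^mu.
Proof.
move=> _ vI; rewrite -torsional_degree_mem.
by apply/(mem_torsion_codeP mu_res f_monic f_size); exists v.
Qed.

Lemma preimage_torsion_gen i : (i < a)%N ->
  exists2 v, p%:R ^+ i * v \in I & v^mu = h^mu ^+ T i.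
Proof.
move=> _; apply/(mem_torsion_codeP mu_res f_monic f_size).
by rewrite torsional_degree_mem.
Qed.

(** The degree bound makes [alpha] its own representative in the quotient, so
    that it vanishes there only if it is 0. *)
Lemma digit_standardP N s alpha : (N <= t)%N ->
  digit mu S h N s alpha <->
  [/\ alpha \is a polyOver S,
      alpha != 0 ->
        (s * (size h).-1 + (size alpha).-1 < N * (size h).-1)%N
    & in_qpoly f alpha \notin ideal_gen [set p%:R; in_qpoly f h] :\ 0].
Proof.
move=> Nt; rewrite in_setD1 (mem_ideal_p_h mu_res f_monic f_size f_mu) // negb_and negbK.
split=> -[alphaS alpha_lt alphaP]; split=> //.
  by case: alphaP => [->|->]; rewrite ?rmorph0 ?eqxx ?orbT.
have [|alpha0] := eqVneq alpha 0; first by left.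
right; case/orP: alphaP => [/eqP alpha_f|//].
have small : (size alpha < size (mk_monic f))%N.
  rewrite mk_monic_id // size_power_lift ltnS -[size alpha]prednK ?size_poly_gt0 //.
  apply: leq_ltn_trans (leq_addl _ _) _; apply: leq_trans (alpha_lt alpha0) _.
  by rewrite leq_mul2r Nt orbT.
by move: alpha0; rewrite -(in_qpoly_small small) alpha_f eqxx.
Qed.

(** In the case of maximal torsional degree, [f] itself is the element of the
    preimage of [C] with the right torsion; it represents the generator 0. *)
Lemma standard_form_exists (i : 'I_a) : exists G : {poly A},
  [/\ standard i (in_qpoly f G), p%:R ^+ i * G \in I & G^mu = h^mu ^+ T i].
Proof.
have [I0 IDM] := preimage_ideal.
have [Tt|Tt] := eqVneq (T i) t.
  exists f; have f0 : in_qpoly f f = 0 by rewrite -[X in in_qpoly _ X]mul1r in_qpoly_mull.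
  split; [by split | by rewrite inE in_qpoly_mull // C_ideal.1 | by rewrite Tt].
have [v vI vE] := preimage_torsion_gen (ltn_ord i).
have [w wE] : exists w, v - h ^+ T i = p%:R * w.
  by apply: (mu_poly_eq0 mu_res); rewrite rmorphB rmorphXn /= vE subrr.
have [|s [alpha [alphaP tailI]]] := reduce_tail mu_res (teichmuller0 _ _ _) S_surj
  h_monic h_irr p_nilp I0 IDM preimage_torsion_gen (i := i) (k := 1) w.
  by rewrite addn1.
exists (h ^+ T i + tail p h a i 1 s alpha); split.
- split=> // [/eqP|_]; first by rewrite (negPf Tt).
  exists s, alpha; split=> // j /alphaP.
  by move/digit_standardP; apply; apply: torsional_degree_le.
- rewrite (_ : _ * _ = -1 * (p%:R ^+ i * (p%:R ^+ 1 * w - tail p h a i 1 s alpha))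
    + p%:R ^+ i * v); first exact: IDM tailI vI.
  have -> : v = h ^+ T i + p%:R * w by rewrite -wE addrC subrK.
  rewrite expr1; move: (tail _ _ _ _ _ _ _) (h ^+ T i) (p%:R ^+ i) => x y z.
  by ring.
rewrite rmorphD rmorphXn /= /tail big_nat rmorph_sum big1 ?addr0 // => j /andP[j_gt0 _].
rewrite -(prednK j_gt0) exprS -!mulrA rmorphM /= mu_poly_natr -polyC_natr.
by rewrite (mu_char mu_res) mul0r.
Qed.

(** Two standard forms of index [i] share the term [h ^ T i], so their
    difference is a tail whose coefficients are differences of digits, to which
    [reduced_tail_eq0] applies. *)
Lemma standard_form_unique (i : 'I_a) x y : standard i x -> standard i y ->
  p%:R ^+ i * x \in C -> p%:R ^+ i * y \in C -> x = y.
Proof.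
have [I0 IDM] := preimage_ideal.
move=> [x_max x_std] [y_max y_std] xC yC.
have [Tt|/eqP Tt] := eqVneq (T i) t; first by rewrite x_max // y_max.
have [s [alpha [sP xE]]] := x_std Tt; have [s' [alpha' [s'P yE]]] := y_std Tt.
have digits j : (1 <= j < a - i)%N ->
    digit mu S h (T (i + j)) (s j) (alpha j) /\
    digit mu S h (T (i + j)) (s' j) (alpha' j).
  by move=> jP; split; apply/digit_standardP; rewrite ?torsional_degree_le;
    [|apply: sP| |apply: s'P].
pose e j := h ^+ s j * alpha j - h ^+ s' j * alpha' j.
suff e0 j : (1 <= j < a - i)%N -> e j = 0.
  rewrite xE yE; congr (in_qpoly f (_ + _)); apply: eq_big_nat => j jP.
  by rewrite -!mulrA (subr0_eq (e0 j jP)).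
apply: (reduced_tail_eq0 mu_res h_monic preimage_torsion_dvd) => [k|k|].
- move=> /digits[/(digit_size h_monic) dk /(digit_size h_monic) d'k]; rewrite rmorphB /=.
  by apply: leq_trans (size_polyD _ _) _; rewrite size_polyN geq_max dk d'k.
- move=> /digits[dk d'k] /eqP; rewrite rmorphB subr_eq0 => /eqP.
  by move/(digit_inj (teichmuller0 _ _ _) S_inj h_irr dk d'k) => ekE; rewrite /e ekE subrr.
have -> : \sum_(1 <= j < a - i) p%:R ^+ j * e j =
    (h ^+ T i + tail p h a i 1 s alpha) - (h ^+ T i + tail p h a i 1 s' alpha').
  rewrite opprD addrACA subrr add0r -sumrB; apply: eq_bigr => k _.
  by rewrite mulrBr !mulrA.
have [_ CDM] := C_ideal.
by rewrite inE in_qpoly_natrM rmorphB /tail /= -xE -yE mulrBr addrC -mulN1r CDM.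
Qed.

Lemma standard_generators_exist_unique : exists g : 'I_a -> {poly %/ f},
  standard_generators p m zeta mu h t C g /\
  forall g', standard_generators p m zeta mu h t C g' -> g' =1 g.
Proof.
have genC (g : 'I_a -> {poly %/ f}) (i : 'I_a) : C = ideal_gen (generating_set p g) ->
    p%:R ^+ i * g i \in C.
  by move=> ->; apply: ideal_gen_id; apply: imset_f.
have [I0 IDM] := preimage_ideal.
have [G GP] := fin_all_exists standard_form_exists.
pose g i := in_qpoly f (G i).
have gP : standard_generators p m zeta mu h t C g.
  split=> [|i]; last by have [] := GP i.
  apply/eqP; rewrite eqEsubset; apply/andP; split; apply/subsetP => x.
    rewrite -[x]in_qpoly_val => xI.
    pose Gn i := oapp G 0 (insub i).
    have GnE (i : 'I_a) : Gn i = G i by rewrite /Gn valK.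
    have [i ia|c ->] := torsion_generators mu_res p_nilp IDM
      preimage_torsion_dvd (G := Gn) _ xI.
      by rewrite (GnE (Ordinal ia)); have [] := GP (Ordinal ia).
    rewrite rmorph_sum big_mkord; apply: is_ideal_sum (ideal_gen_ideal _) _ => i _.
    rewrite rmorphM; apply: is_idealM (ideal_gen_ideal _) _; apply: ideal_gen_id.
    by apply/imsetP; exists i; rewrite //= GnE in_qpoly_natrM.
  apply: (ideal_gen_min C_ideal) => y /imsetP[i _ ->].
  by have [_] := GP i; rewrite inE in_qpoly_natrM.
exists g; split=> // g' [g'C g'P] i.
have [gC g_std] := gP; apply: (standard_form_unique (g'P i) (g_std i)).
  exact: genC.
exact: genC.
Qed.

End StandardForm.

Theorem theorem3p11
  (p a m : nat) (p_prime : prime p) (a_ge1 : (1 <= a)%N) (m_ge1 : (1 <= m)%N)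
  (GR : finComNzRingType) (GR_galois : galois_ring p a m GR)
  (F : finFieldType) (mu : {rmorphism GR -> F}) (mu_res : residue_map p m mu)
  (zeta : GR) (zeta_order : ((p ^ m).-1).-primitive_root zeta)
  (f h beta : {poly GR}) (t : nat)
  (f_monic : f \is monic) (f_regular : GRing.lreg f)
  (f_primary : primary_elt f) (f_nonunit : ~ is_unit f)
  (t_ge1 : (1 <= t)%N)
  (h_monic : h \is monic) (h_irr : basic_irreducible mu h)
  (h_teich : h \is a polyOver (teichmuller p m zeta))
  (beta_deg : (size beta <= t * (size h).-1)%N)
  (f_eq : f = h ^+ t + p%:R * beta)
  (C : {set {poly %/ f}}) (C_ideal : is_ideal C) :
  exists g : 'I_a -> {poly %/ f},
    standard_generators p m zeta mu h t C g /\
    (forall g' : 'I_a -> {poly %/ f},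
       standard_generators p m zeta mu h t C g' ->
       generating_set p g' = generating_set p g).
Proof.
have p_nilp : p%:R ^+ a = 0 :> GR.
  by have [charGR _ _] := GR_galois; rewrite -natrX; apply/eqP; rewrite charGR.
have f_mu : map_poly mu f = map_poly mu h ^+ t.
  rewrite f_eq rmorphD rmorphM rmorphXn /= mu_poly_natr -polyC_natr.
  by rewrite (mu_char mu_res) mul0r addr0.
have [g [gP g_unique]] := standard_generators_exist_unique mu_res
  (teichmuller_inj mu_res p_prime m_ge1 p_nilp zeta_order)
  (teichmuller_surj mu_res p_prime m_ge1 p_nilp zeta_order)
  p_nilp f_monic h_monic t_ge1 h_irr.2 f_mu C_ideal.
exists g; split=> // g' /g_unique gg'.
by apply: eq_imset => i; rewrite /= gg'.
Qed.
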